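(* Let $A,B,C$ be rings and let $(\mathrm{Mod}\,A,\mathrm{Mod}\,B,\mathrm{Mod}\,C)$ be a recollement of module categories with functors $i_*:\mathrm{Mod}\,A\to\mathrm{Mod}\,B$, $i^*,i^!:\mathrm{Mod}\,B\to\mathrm{Mod}\,A$, $j^*:\mathrm{Mod}\,B\to\mathrm{Mod}\,C$, $j_!,j_*:\mathrm{Mod}\,C\to\mathrm{Mod}\,B$. Let $\mathcal X'$, $\mathcal X$ and $\mathcal X''$ be the subcategories consisting of all flat modules in $\mathrm{Mod}\,A$, $\mathrm{Mod}\,B$ and $\mathrm{Mod}\,C$ respectively. Then: (1) $\operatorname{cot.dim}\mathrm{Mod}\,B\le\operatorname{cot.dim}\mathrm{Mod}\,A+\operatorname{cot.dim}\mathrm{Mod}\,C+\max\{\operatorname{cot.dim}i_*(\mathcal X'^\perp),\ \operatorname{cot.dim}j_*(\mathcal X''^\perp)\}+1$. (2) $\operatorname{cot.dim}\mathrm{Mod}\,C\le\operatorname{cot.dim}\mathrm{Mod}\,B+\operatorname{cot.dim}j^*(\mathcal X^\perp)$. (3) If $j^*(\mathcal X^\perp)\subseteq\mathcal X''^\perp$, then $\operatorname{cot.dim}\mathrm{Mod}\,C\le\operatorname{cot.dim}\mathrm{Mod}\,B$; in particular, if $B$ is right perfect, then so is $C$. (4) If $i^!$ is exact and $i^!(\mathcal X^\perp)\subseteq\mathcal X'^\perp$, then $\operatorname{cot.dim}\mathrm{Mod}\,A\le\operatorname{cot.dim}\mathrm{Mod}\,B$; in particular, if $B$ is right perfect, then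 so is $A$.
   Context: For a ring $A$, $\mathrm{Mod}\,A$ is the category of all right $A$-modules. For a class $\mathcal X$ of modules over a fixed ring, $\mathcal X^\perp$ is the class of modules $M$ with $\operatorname{Ext}^i(X,M)=0$ for all $i\ge1$ and $X\in\mathcal X$. When $\mathcal X$ is the class of flat $A$-modules, the modules in $\mathcal X^\perp$ are called cotorsion, and the cotorsion dimension $\operatorname{cot.dim}M$ of an $A$-module $M$ is the least $n\ge0$ for which there is an exact sequence $0\to M\to X_0\to\cdots\to X_n\to0$ with all $X_i\in\mathcal X^\perp$ ($\infty$ if none). For a class $\mathcal M$ of $A$-modules, $\operatorname{cot.dim}\mathcal M=\sup\{\operatorname{cot.dim}M\mid M\in\mathcal M\}$. For a functor $F$, $F(\mathcal X)$ denotes the class of objects isomorphic to some $F(X)$, $X\in\mathcal X$. A recollement $(\mathcal A,\mathcal B,\mathcal C)$ of abelian categories is given by additive functors $i_*:\mathcal A\to\mathcal B$, $i^*,i^!:\mathcal B\to\mathcal A$, $j^*:\mathcal B\to\mathcal C$, $j_!,j_*:\mathcal C\to\mathcal B$ such that $(i^*,i_*,i^!)$ and $(j_!,j^*,j_* )$ are adjoint triples, $i_*,j_!,j_*$ are fully faithful, and $\operatorname{Im}i_*=\operatorname{Ker}j^*$ (essential image). *)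

(* Defs.v *)
From HB Require Import structures.
From mathcomp Require Import all_boot all_order all_algebra.
From mathcomp Require Import boolp.

Set Implicit Arguments.
Unset Strict Implicit.
Unset Printing Implicit Defensive.

Import GRing.Theory.
Local Open Scope ring_scope.

(* Values in {0, 1, 2, ...} with infinity; None is infinity. *)
Definition enat := option nat.

Declare Scope enat_scope.
Delimit Scope enat_scope with enat.
Bind Scope enat_scope with enat.

Definition enat_le (x y : enat) : bool :=
  match x, y with
  | _, None => true
  | None, Some _ => false
  | Some m, Some n => (m <= n)%N
  end.

Definition enat_add (x y : enat) : enat :=
  match x, y with
  | Some m, Some n => Some (m + n)%N
  | _, _ => None
  end.

Definition enat_max (x y : enat) : enat :=
  match x, y with
  | Some m, Some n => Some (maxn m n)
  | _, _ => None
  end.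

Notation "x <= y" := (enat_le x y) : enat_scope.
Notation "x + y" := (enat_add x y) : enat_scope.

(* The least n satisfying P, or infinity if there is none. *)
Definition least (P : nat -> Prop) : enat :=
  if pselect (exists n, `[< P n >]) is left exP then Some (ex_minn exP)
  else None.

(* Right A-modules are left modules over the converse ring A^c:
   m . a is (a : A^c) *: m. *)
Notation rmodType A := (lmodType A^c).

Definition rmod_class (A : pzRingType) := rmodType A -> Prop.

Definition all_rmod (A : pzRingType) : rmod_class A := fun _ => True.

Definition subclass (A : pzRingType) (X Y : rmod_class A) : Prop :=
  forall M, X M -> Y M.

Definition iso_rmod (A : pzRingType) (M N : rmodType A) : Prop :=
  exists f : {linear M -> N}, bijective f.

Section Exactness.
Variables (U V W : zmodType) (f : U -> V) (g : V -> W).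

Definition surj : Prop := forall w, exists v, g v = w.

Definition exact_at : Prop := forall v, g v = 0 <-> exists u, f u = v.

Definition short_exact : Prop := [/\ injective f, exact_at & surj].

End Exactness.

Section Flatness.
Variable A : pzRingType.

Definition balanced (M : rmodType A) (N : lmodType A) (T : zmodType)
    (t : M -> N -> T) : Prop :=
  [/\ forall m m' n, t (m + m') n = t m n + t m' n,
      forall m n n', t m (n + n') = t m n + t m n' &
      forall (a : A) m n, t ((a : A^c) *: m) n = t m (a *: n)].

Definition is_tensor (M : rmodType A) (N : lmodType A) (T : zmodType)
    (t : M -> N -> T) : Prop :=
  balanced t /\
  forall (U : zmodType) (b : M -> N -> U), balanced b ->
    exists2 h : {additive T -> U},
      (forall m n, h (t m n) = b m n) &
      (forall k : {additive T -> U}, (forall m n, k (t m n) = b m n) ->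
         k =1 h).

(* The functor M (x)_A - from left A-modules to abelian groups is exact; the
   abelian groups Ti are the tensor products of M and Ni, and u, v are the
   maps induced by f and g. *)
Definition flat : rmod_class A := fun M =>
  forall (N1 N2 N3 : lmodType A)
    (f : {linear N1 -> N2}) (g : {linear N2 -> N3}),
  short_exact f g ->
  forall (T1 T2 T3 : zmodType)
    (t1 : M -> N1 -> T1) (t2 : M -> N2 -> T2) (t3 : M -> N3 -> T3),
  is_tensor t1 -> is_tensor t2 -> is_tensor t3 ->
  forall (u : {additive T1 -> T2}) (v : {additive T2 -> T3}),
  (forall m n, u (t1 m n) = t2 m (f n)) ->
  (forall m n, v (t2 m n) = t3 m (g n)) ->
  short_exact u v.

End Flatness.

Section Homology.
Variable A : pzRingType.

Definition projective (P : rmodType A) : Prop :=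
  forall (M N : rmodType A) (g : {linear M -> N}) (f : {linear P -> N}),
  surj g -> exists h : {linear P -> M}, g \o h =1 f.

Record proj_resolution (X : rmodType A) := ProjResolution {
  pr_obj :> nat -> rmodType A;
  pr_diff : forall n, {linear pr_obj n.+1 -> pr_obj n};
  pr_aug : {linear pr_obj 0%N -> X};
  pr_proj : forall n, projective (pr_obj n);
  pr_aug_surj : surj pr_aug;
  pr_exact0 : exact_at (pr_diff 0%N) pr_aug;
  pr_exact : forall n, exact_at (pr_diff n.+1) (pr_diff n)
}.

(* Ext^i(X, M) = 0, i.e. H^i(Hom(P, M)) = 0 for the projective resolutions P
   of X; resolutions exist and the cohomology does not depend on the choice. *)
Definition Ext_vanishes (i : nat) (X M : rmodType A) : Prop :=
  forall P : proj_resolution X,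
  match i with
  | 0 => forall f : {linear P 0%N -> M},
      (forall x, f (pr_diff P 0%N x) = 0) -> forall x, f x = 0
  | j.+1 => forall f : {linear P j.+1 -> M},
      (forall x, f (pr_diff P j.+1 x) = 0) ->
      exists g : {linear P j -> M}, forall x, f x = g (pr_diff P j x)
  end.

Definition Ext_perp (X : rmod_class A) : rmod_class A := fun M =>
  forall (i : nat) (N : rmodType A), (1 <= i)%N -> X N -> Ext_vanishes i N M.

Definition cotorsion : rmod_class A := Ext_perp (@flat A).

(* There is an exact sequence 0 -> M -> Y_0 -> ... -> Y_n -> 0 with all the Y_i
   in the class Y; the sequence is continued by zero modules beyond Y_n. *)
Definition has_coresolution (Y : rmod_class A) (n : nat) (M : rmodType A) :
    Prop :=
  exists (X : nat -> rmodType A) (d : forall i, {linear X i -> X i.+1})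
    (e : {linear M -> X 0%N}),
  [/\ injective e, exact_at e (d 0%N),
      forall i, exact_at (d i) (d i.+1),
      forall i, (i <= n)%N -> Y (X i) &
      forall i, (n < i)%N -> forall x : X i, x = 0].

Definition cotdim (M : rmodType A) : enat :=
  least (fun n => has_coresolution cotorsion n M).

(* The supremum of cotdim over the class X, as the least upper bound. *)
Definition cotdim_class (X : rmod_class A) : enat :=
  least (fun n => forall M, X M -> (cotdim M <= Some n)%enat).

(* The kernel of p is a superfluous submodule of P: ker p + L = P implies
   L = P. *)
Definition superfluous_ker (P M : rmodType A) (p : {linear P -> M}) : Prop :=
  forall L : {pred P}, submod_closed L ->
  (forall x, exists k l, [/\ p k = 0, l \in L & x = k + l]) ->
  forall x, x \in L.

Definition projective_cover (P M : rmodType A) (p : {linear P -> M}) : Prop :=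
  [/\ projective P, surj p & superfluous_ker p].

Definition right_perfect : Prop :=
  forall M : rmodType A,
  exists (P : rmodType A) (p : {linear P -> M}), projective_cover p.

End Homology.

Record rmod_functor (A B : pzRingType) := RmodFunctor {
  fobj :> rmodType A -> rmodType B;
  fmap : forall M N : rmodType A, {linear M -> N} -> {linear fobj M -> fobj N};
  fmap_id : forall M : rmodType A, fmap (idfun : {linear M -> M}) =1 id;
  fmap_comp : forall (M N Q : rmodType A)
    (g : {linear N -> Q}) (f : {linear M -> N}),
    fmap (g \o f : {linear M -> Q}) =1 fmap g \o fmap f
}.
Arguments fmap {A B} F {M N} f : rename.

Section Functors.
Variables A B : pzRingType.
Implicit Type F : rmod_functor A B.

Definition additive_functor F : Prop :=
  forall (M N : rmodType A) (f g : {linear M -> N}),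
  fmap F (f \+ g : {linear M -> N}) =1 fmap F f \+ fmap F g.

Definition exact_functor F : Prop :=
  forall (M N Q : rmodType A) (f : {linear M -> N}) (g : {linear N -> Q}),
  short_exact f g -> short_exact (fmap F f) (fmap F g).

Definition fully_faithful F : Prop :=
  forall M N : rmodType A, bijective (@fmap _ _ F M N).

Definition fimage F (X : rmod_class A) : rmod_class B := fun N =>
  exists2 M, X M & iso_rmod (F M) N.

Definition fkernel F : rmod_class A := fun M => forall x : F M, x = 0.

End Functors.

Record adjunction (A B : pzRingType)
    (L : rmod_functor A B) (R : rmod_functor B A) := Adjunction {
  adj_unit : forall M : rmodType A, {linear M -> R (L M)};
  adj_counit : forall N : rmodType B, {linear L (R N) -> N};
  adj_unit_nat : forall (M M' : rmodType A) (f : {linear M -> M'}),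
    adj_unit M' \o f =1 fmap R (fmap L f) \o adj_unit M;
  adj_counit_nat : forall (N N' : rmodType B) (g : {linear N -> N'}),
    g \o adj_counit N =1 adj_counit N' \o fmap L (fmap R g);
  adj_triangleL : forall M : rmodType A,
    adj_counit (L M) \o fmap L (adj_unit M) =1 id;
  adj_triangleR : forall N : rmodType B,
    fmap R (adj_counit N) \o adj_unit (R N) =1 id
}.

(* i_low, i_up, i_shriek stand for i_*, i^*, i^!, and j_up, j_shriek, j_low
   for j^*, j_!, j_*. *)
Record recollement (A B C : pzRingType) := Recollement {
  i_low : rmod_functor A B;
  i_up : rmod_functor B A;
  i_shriek : rmod_functor B A;
  j_up : rmod_functor B C;
  j_shriek : rmod_functor C B;
  j_low : rmod_functor C B;
  i_low_additive : additive_functor i_low;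
  i_up_additive : additive_functor i_up;
  i_shriek_additive : additive_functor i_shriek;
  j_up_additive : additive_functor j_up;
  j_shriek_additive : additive_functor j_shriek;
  j_low_additive : additive_functor j_low;
  adj_i_up_low : adjunction i_up i_low;
  adj_i_low_shriek : adjunction i_low i_shriek;
  adj_j_shriek_up : adjunction j_shriek j_up;
  adj_j_up_low : adjunction j_up j_low;
  i_low_ff : fully_faithful i_low;
  j_shriek_ff : fully_faithful j_shriek;
  j_low_ff : fully_faithful j_low;
  im_i_low_ker_j_up : forall N : rmodType B,
    fimage i_low (@all_rmod A) N <-> fkernel j_up N
}.

(* Main.v *)
Require Import Defs.
From HB Require Import structures.
From mathcomp Require Import all_boot all_order all_algebra.
From mathcomp Require Import boolp classical_sets.

(** Cotorsion dimension is an Ext-dimension. Call the injective dimension of M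
    relative to a class X at most n when Ext^i(F, M) = 0 for all F in X and
    i > n. Short exact sequences shift this dimension in the usual way, and
    every module embeds in an injective module, which lies in the class of
    dimension 0; so dimension at most n is the same as having a coresolution of
    length n by modules of dimension 0 (has_coresolution_Ext_perp). For X the
    flat modules this says that cot.dim M <= n is the vanishing of Ext^i(F, M)
    for F flat and i > n (cotdim_le).

    Embedding Z in an injective module and inducting on the dimension shows
    that an exact functor which sends modules of dimension 0 to modules of
    dimension at most m sends modules of dimension k to modules of dimension at
    most k + m (injdim_le_functor). Since N is isomorphic to j^* (j_* N) and Z
    to i^! (i_* Z), this gives (2) and the inequalities of (3) and (4).

    For (1), let a, c and m be the three quantities on the right, the last one
    being the maximum. A B-module killed by j^* comes from some i_* Z, so it has
    dimension at most a + m. The functor j_* is only left exact, but the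
    cokernel of j_* v for v surjective is killed by j^*, so each step of a
    coresolution over C can be corrected, and j_* N has dimension at most
    a + c + m + 1 (injdim_le_j_low). Finally j^* inverts the unit
    M -> j_* j^* M, whose kernel and cokernel are therefore killed by j^*, and
    the bound passes from j_* j^* M to M (injdim_le_recollement).

    Right perfectness is transported by moving projective covers. For a
    C-module N with projective cover Q -> j_! N, the map j^* Q -> N is a
    projective cover; for an A-module Z with projective cover Q -> i_* Z, its
    transpose i^* Q -> Z is one. *)

Set Implicit Arguments.
Unset Strict Implicit.
Unset Printing Implicit Defensive.

Import Order.TTheory GRing.Theory Num.Theory.
Local Open Scope ring_scope.

(** * Submodules, quotients and factorizations of linear maps *)

Section LinearMaps.
Variable R : pzRingType.
Implicit Types U V W : lmodType R.

Lemma linear_ext U V (f g : {linear U -> V}) : f =1 g -> f = g.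
Proof.
case: f g => f [[fD] [fZ]] [g [[gD] [gZ]]] /funext/= fg.
rewrite {}fg in fD fZ *.
by rewrite (Prop_irrelevance fD gD) (Prop_irrelevance fZ gZ).
Qed.

Definition mk_linear U V (f : U -> V) (lf : linear f) : {linear U -> V} :=
  HB.pack f (GRing.isLinear.Build R U V *:%R f lf).

Lemma linear_inj0 U V (f : {linear U -> V}) :
  (forall x, f x = 0 -> x = 0) -> injective f.
Proof.
by move=> f0 x y e; apply/subr0_eq/f0; rewrite linearB e subrr.
Qed.

(** The two factorization lemmas replace the universal properties of kernels
    and cokernels in all the diagram chases below. *)
Lemma lift_inj U V W (u : {linear U -> V}) (f : {linear W -> V}) :
  injective u -> (forall w, exists x, u x = f w) ->
  exists k : {linear W -> U}, u \o k =1 f.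
Proof.
move=> uI /choice[k kP]; have lk : linear k.
  by move=> a x y; apply: uI; rewrite linearP !kP linearP.
by exists (mk_linear lk).
Qed.

Lemma lift_surj U V W (v : {linear U -> V}) (f : {linear U -> W}) :
  surj v -> (forall x, v x = 0 -> f x = 0) ->
  exists k : {linear V -> W}, k \o v =1 f.
Proof.
move=> /choice[s sP] vf.
have fs x : f (s (v x)) = f x.
  by apply/subr0_eq; rewrite -linearB; apply: vf; rewrite linearB sP subrr.
have lk : linear (f \o s).
  by move=> a x y; rewrite /= -[RHS]linearP -[RHS]fs [v _]linearP !sP.
by exists (mk_linear lk).
Qed.

Section Submodule.
Variables (U : lmodType R) (S : U -> Prop).
Hypotheses (S0 : S 0) (SP : forall a x y, S x -> S y -> S (a *: x + y)).

Definition submod := {x : U | S x}.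
HB.instance Definition _ := gen_eqMixin submod.
HB.instance Definition _ := gen_choiceMixin submod.

Let submod_eq (x y : submod) : sval x = sval y -> x = y.
Proof. by case: x y => x Sx [y Sy] /= e; apply: eq_exist. Qed.

Let SZ a x : S x -> S (a *: x).
Proof. by move=> Sx; rewrite -[a *: x]addr0; apply: SP. Qed.

Let SD x y : S x -> S y -> S (x + y).
Proof. by move=> Sx Sy; rewrite -[x]scale1r; apply: SP. Qed.

Let SN x : S x -> S (- x).
Proof. by move=> Sx; rewrite -scaleN1r; apply: SZ. Qed.

Let zero : submod := exist _ 0 S0.
Let opp (x : submod) : submod := exist _ _ (SN (svalP x)).
Let add (x y : submod) : submod := exist _ _ (SD (svalP x) (svalP y)).
Let scale a (x : submod) : submod := exist _ _ (SZ a (svalP x)).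

Let addA : associative add. Proof. by move=> *; apply/submod_eq/addrA. Qed.
Let addC : commutative add. Proof. by move=> *; apply/submod_eq/addrC. Qed.
Let add0 : left_id zero add. Proof. by move=> *; apply/submod_eq/add0r. Qed.
Let addN : left_inverse zero opp add.
Proof. by move=> *; apply/submod_eq/addNr. Qed.

HB.instance Definition _ := GRing.isZmodule.Build submod addA addC add0 addN.

Let scaleA a b x : scale a (scale b x) = scale (a * b) x.
Proof. exact/submod_eq/scalerA. Qed.
Let scale1 : left_id 1 scale.
Proof. by move=> *; apply/submod_eq/scale1r. Qed.
Let scaleDr : right_distributive scale +%R.
Proof. by move=> *; apply/submod_eq/scalerDr. Qed.
Let scaleDl x : {morph scale^~ x : a b / a + b}.
Proof. by move=> *; apply/submod_eq/scalerDl. Qed.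

HB.instance Definition _ :=
  GRing.Zmodule_isLmodule.Build R submod scaleA scale1 scaleDr scaleDl.

Lemma submodule_exists : exists (K : lmodType R) (k : {linear K -> U}),
  injective k /\ forall x, S x <-> exists y, k y = x.
Proof.
have lk : linear (sval : submod -> U) by [].
exists submod, (mk_linear lk); split; first exact: submod_eq.
by move=> x; split=> [Sx|[[y Sy] /= <-//]]; exists (exist _ x Sx).
Qed.

End Submodule.

Section Quotient.
Variables (U : lmodType R) (S : U -> Prop).
Hypotheses (S0 : S 0) (SP : forall a x y, S x -> S y -> S (a *: x + y)).

Let SZ a x : S x -> S (a *: x).
Proof. by move=> Sx; rewrite -[a *: x]addr0; apply: SP. Qed.
Let SD x y : S x -> S y -> S (x + y).
Proof. by move=> Sx Sy; rewrite -[x]scale1r; apply: SP. Qed.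
Let SN x : S x -> S (- x).
Proof. by move=> Sx; rewrite -scaleN1r; apply: SZ. Qed.

Let coset x : U -> Prop := fun y => S (x - y).

(** Classes are represented by canonical elements: a choice function on
    subsets of U, applied to cosets, picks the same element for equal cosets. *)
Lemma coset_repr_exists : exists c : U -> U,
  (forall x, S (x - c x)) /\ (forall x y, S (x - y) -> c x = c y).
Proof.
have coset_eq x y : S (x - y) -> coset x = coset y.
  move=> Sxy; apply/funext => z; apply/propext; split=> h.
    by rewrite /coset -(subrKA x) -opprB; apply: SD => //; apply: SN.
  by rewrite /coset -(subrKA y); apply: SD.
have /choice[p pP] (T : U -> Prop) : exists y, (exists z, T z) -> T y.
  by have [[z Tz]|nT] := pselect (exists z, T z); [exists z | exists 0].
exists (p \o coset); split=> [x|x y /coset_eq/=->//].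
by apply: (pP (coset x)); exists x; rewrite /coset subrr.
Qed.

Variable c : U -> U.
Hypotheses (cS : forall x, S (x - c x))
  (c_eq : forall x y, S (x - y) -> c x = c y).

Definition quot := {x : U | c x = x}.
HB.instance Definition _ := gen_eqMixin quot.
HB.instance Definition _ := gen_choiceMixin quot.

Let cc x : c (c x) = c x.
Proof. by apply: c_eq; rewrite -opprB; apply: SN. Qed.

Let pi x : quot := exist _ (c x) (cc x).
Let piE x y : S (x - y) -> pi x = pi y.
Proof. by move=> Sxy; apply/eq_exist/c_eq. Qed.
Let pi_surj q : exists x, pi x = q.
Proof. by case: q => x cx; exists x; apply: eq_exist. Qed.
Let pi_ker x : pi x = pi 0 -> S x.
Proof.
move=> /(congr1 sval)/= e; rewrite -[x]addr0 -(addNr (c x)) addrA.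
by apply: SD => //; rewrite e -[c 0]subr0 -opprB; apply: SN.
Qed.

Let zero := pi 0.
Let opp (x : quot) := pi (- sval x).
Let add (x y : quot) := pi (sval x + sval y).
Let scale a (x : quot) := pi (a *: sval x).

Let oppE x : opp (pi x) = pi (- x).
Proof. by apply: piE; rewrite /= opprK addrC. Qed.
Let addE x y : add (pi x) (pi y) = pi (x + y).
Proof.
by apply/esym/piE; rewrite /= opprD addrACA; apply: SD.
Qed.
Let scaleE a x : scale a (pi x) = pi (a *: x).
Proof. by apply/esym/piE; rewrite /= -scalerBr; apply: SZ. Qed.

Let addA : associative add.
Proof.
move=> p q r; have [[[x <-] [y <-]] [z <-]] := (pi_surj p, pi_surj q, pi_surj r).
by rewrite !addE addrA.
Qed.
Let addC : commutative add.
Proof. by move=> p q; rewrite /add addrC. Qed.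
Let add0 : left_id zero add.
Proof. by move=> p; have [x <-] := pi_surj p; rewrite addE add0r. Qed.
Let addN : left_inverse zero opp add.
Proof. by move=> p; have [x <-] := pi_surj p; rewrite oppE addE addNr. Qed.

HB.instance Definition _ := GRing.isZmodule.Build quot addA addC add0 addN.

Let scaleA a b p : scale a (scale b p) = scale (a * b) p.
Proof. by have [x <-] := pi_surj p; rewrite !scaleE scalerA. Qed.
Let scale1 : left_id 1 scale.
Proof. by move=> p; have [x <-] := pi_surj p; rewrite scaleE scale1r. Qed.
Let scaleDr : right_distributive scale +%R.
Proof.
move=> a p q; have [[x <-] [y <-]] := (pi_surj p, pi_surj q).
by rewrite -[pi x + pi y]/(add _ _) addE !scaleE -[RHS]/(add _ _) addE scalerDr.
Qed.
Let scaleDl p : {morph scale^~ p : a b / a + b}.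
Proof.
move=> a b; have [x <-] := pi_surj p.
by rewrite !scaleE -[RHS]/(add _ _) addE scalerDl.
Qed.

HB.instance Definition _ :=
  GRing.Zmodule_isLmodule.Build R quot scaleA scale1 scaleDr scaleDl.

Lemma quotient_of_repr : exists (Q : lmodType R) (q : {linear U -> Q}),
  surj q /\ forall x, S x <-> q x = 0.
Proof.
have lq : linear (pi : U -> quot).
  by move=> a x y; rewrite -addE -scaleE.
exists quot, (mk_linear lq); split; first exact: pi_surj.
by move=> x; split=> [Sx|/pi_ker//]; apply: piE; rewrite subr0.
Qed.

End Quotient.

Lemma quotient_exists U (S : U -> Prop) :
  S 0 -> (forall a x y, S x -> S y -> S (a *: x + y)) ->
  exists (Q : lmodType R) (q : {linear U -> Q}),
    surj q /\ forall x, S x <-> q x = 0.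
Proof.
move=> S0 SP; have [c [cS c_eq]] := coset_repr_exists S0 SP.
exact: (quotient_of_repr S0 SP cS c_eq).
Qed.

Lemma kernel_exists U V (f : {linear U -> V}) :
  exists (K : lmodType R) (k : {linear K -> U}), injective k /\ exact_at k f.
Proof.
apply: submodule_exists; first exact: linear0.
by move=> a x y fx fy; rewrite linearP fx fy scaler0 addr0.
Qed.

Lemma cokernel_exists U V (f : {linear U -> V}) :
  exists (Q : lmodType R) (q : {linear V -> Q}), exact_at f q /\ surj q.
Proof.
have [||Q [q [qS qP]]] := @quotient_exists V (fun y => exists x, f x = y).
- by exists 0; rewrite linear0.
- by move=> a _ _ [x <-] [y <-]; exists (a *: x + y); rewrite linearP.
by exists Q, q; split=> // x; rewrite qP.
Qed.

Lemma image_factorization U V (f : {linear U -> V}) :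
  exists (J : lmodType R) (p : {linear U -> J}) (k : {linear J -> V}),
    [/\ surj p, injective k & k \o p =1 f].
Proof.
have [||J [k [kI kP]]] := @submodule_exists V (fun y => exists x, f x = y).
- by exists 0; rewrite linear0.
- by move=> a _ _ [x <-] [y <-]; exists (a *: x + y); rewrite linearP.
have [|p pP] := lift_inj (f := f) kI; first by move=> x; apply/kP; exists x.
exists J, p, k; split=> // y.
have /kP[x fx] : exists z, k z = k y by exists y.
by exists x; apply: kI; rewrite -fx -(pP x).
Qed.

End LinearMaps.

(** * The divisible group Q/Z *)

(** The group is Q/Z: the class of x / n is an n-th part of that of x, and the
    class of 1 / n has order n. *)
Lemma divisible_torsion_exists : exists D : zmodType,
  (forall n (d : D), (0 < n)%N -> exists e, e *+ n = d) /\
  (forall n, (1 < n)%N -> exists d : D, d != 0 /\ d *+ n = 0).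
Proof.
have [||D [q [qS qP]]] := @quotient_exists int (zmodule rat) (fun x => x \is a Num.int).
- exact: rpred0.
- by move=> a x y xZ yZ; rewrite rpredD// scalezrE rpredMz.
exists D; split=> [n d n0|n n1].
  have [x <-] := qS d; have n0' : n%:R != 0 :> rat by rewrite pnatr_eq0 -lt0n.
  exists (q (x / n%:R : rat)); rewrite -raddfMn; congr (q _).
  by rewrite -[LHS](@mulr_natr rat) divfK.
have n0' : n%:R != 0 :> rat by rewrite pnatr_eq0 -lt0n ltnW.
exists (q (n%:R^-1 : rat)); split.
  apply/negP => /eqP/qP /intrP[m /(congr1 ( *%R^~ n%:R))].
  rewrite mulVf// => /esym/eqP; rewrite -[1]/(1%:~R) -[n%:R]/(n%:Z%:~R) -intrM eqr_int.
  move=> /eqP/(congr1 absz); rewrite abszM /= => /eqP.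
  by rewrite muln_eq1 => /andP[_ /eqP ne]; rewrite ne in n1.
rewrite -raddfMn; apply/qP.
by rewrite -[_ *+ n](@mulr_natr rat) mulVf// rpred1.
Qed.

(** * Extending homomorphisms into divisible groups *)

Section HomExtension.
Local Open Scope classical_set_scope.
Variables G D : zmodType.

(** A homomorphism defined on a subgroup of G is encoded by its graph, so that
    the union of a chain of partial homomorphisms is a plain union of sets. *)
Definition partial_hom (R : set (G * D)) : Prop :=
  [/\ R 0, forall p q, R p -> R q -> R (p - q) & forall d, R (0, d) -> d = 0].

Section PartialHom.
Variable R : set (G * D).
Hypothesis hR : partial_hom R.

Let R0 : R 0. Proof. by case: hR. Qed.
Let RB p q : R p -> R q -> R (p - q). Proof. by case: hR => _ h _; apply: h. Qed.

Lemma partial_homN p : R p -> R (- p).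
Proof. by move=> Rp; rewrite -sub0r; apply: RB. Qed.

Lemma partial_homD p q : R p -> R q -> R (p + q).
Proof. by move=> Rp Rq; rewrite -[q]opprK; apply: RB => //; apply: partial_homN. Qed.

Lemma partial_homMz p n : R p -> R (p *~ n).
Proof.
have Rn k : R p -> R (p *+ k).
  by move=> Rp; elim: k => [|k IH]; rewrite ?mulr0n ?mulrS//; apply: partial_homD.
case: n => k Rp; first exact: Rn.
by rewrite NegzE mulrNz; apply/partial_homN/Rn.
Qed.

Lemma partial_hom_val x d e : R (x, d) -> R (x, e) -> d = e.
Proof.
move=> Rd Re; have [_ _ f] := hR.
by apply/subr0_eq/f; have := RB Rd Re; rewrite [_ - _]surjective_pairing /= subrr.
Qed.

End PartialHom.

Hypothesis divD : forall n (d : D), (0 < n)%N -> exists e, e *+ n = d.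

Let modzE (n k : int) : (n %% k)%Z = n - (n %/ k)%Z * k.
Proof. by rewrite {2}(divz_eq n k) [_ + (_ %% _)%Z]addrC addrK. Qed.

Lemma pairMz (x : G) (d : D) n : (x, d) *~ n = (x *~ n, d *~ n).
Proof.
by apply/eqP; rewrite -pair_eqE; apply/andP; split; apply/eqP;
  [apply: (raddfMz (@fst G D)) | apply: (raddfMz (@snd G D))].
Qed.

(** The multiples of g in the domain of R are the multiples of a least positive
    k, if there are any but 0; a k-th part of the value at k g is compatible
    with R at all of them. *)
Lemma divisible_compatible_value R g : partial_hom R ->
  exists d, forall n e, R (g *~ n, e) -> e = d *~ n.
Proof.
move=> hR; have [_ _ R_fun] := hR.
have [ex|nex] := pselect (exists k, `[< (0 < k)%N /\ exists e, R (g *+ k, e) >]).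
  case: (ex_minnP ex) => k /asboolP[k0 [e0 Re0]] kmin.
  have [d de0] := divD e0 k0; exists d => n e Re.
  have kz : k%:Z != 0 by rewrite -lt0n.
  have Rr : R (g *~ (n %% k)%Z, e - e0 *~ (n %/ k)%Z).
    have := partial_homD hR Re (partial_homN hR (partial_homMz hR (n %/ k)%Z Re0)).
    rewrite pairMz; congr R; congr (_, _) => /=.
    by rewrite pmulrn -mulrzA -mulrzBr modzE mulrC.
  have r0 : (n %% k)%Z = 0.
    have := modz_ge0 n kz; have := ltz_mod n kz.
    case: (n %% k)%Z Rr => // -[//|r] Rr; rewrite ltz_nat absz_nat => rk _.
    suff /kmin : `[< (0 < r.+1)%N /\ exists e, R (g *+ r.+1, e) >] by rewrite leqNgt rk.
    by apply/asboolP; split=> //; eexists; apply: Rr.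
  rewrite r0 mulr0z in Rr; have /subr0_eq -> := R_fun _ Rr.
  by rewrite -de0 pmulrn -mulrzA {2}(divz_eq n k) r0 addr0 mulrC.
exists 0 => n e Re; rewrite mul0rz.
case: n Re => [[|k]|k] Re; first exact: R_fun.
  by case: nex; exists k.+1; apply/asboolP; split=> //; exists e.
case: nex; exists k.+1; apply/asboolP; split=> //; exists (- e).
have := partial_homN hR Re; congr R; congr (_, _).
by rewrite /= NegzE mulrNz opprK.
Qed.

(** Divisible groups are injective, by Zorn's lemma: a maximal partial
    homomorphism is total, as a value compatible with it at a missing g would
    extend it. *)
Lemma hom_extension R0 : partial_hom R0 ->
  exists f : {additive G -> D}, forall x d, R0 (x, d) -> f x = d.
Proof.
move=> hR0.
(* The empty set is admitted because the union of an empty chain is empty. *)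
pose P (R : set (G * D)) := R = set0 \/ (partial_hom R /\ R0 `<=` R).
have chain (F : set (set (G * D))) : F `<=` P -> total_on F subset ->
    P (\bigcup_(X in F) X).
  move=> FP Ftot.
  have [[X [FX [x Xx]]]|none] := pselect (exists X, F X /\ exists x, X x); last first.
    left; apply/seteqP; split=> // x [X FX Xx].
    by apply: none; exists X; split=> //; exists x.
  have Fhom Y y : F Y -> Y y -> partial_hom Y /\ R0 `<=` Y.
    by move=> /FP[->|//] [].
  have [[X0 _ _] R0X] := Fhom _ _ FX Xx.
  right; split; last by move=> y R0y; exists X => //; apply: R0X.
  split=> [|p q [Y FY Yp] [Z FZ Zq]|d [Y FY Yd]]; first by exists X.
    have [YZ|ZY] := Ftot _ _ FY FZ.
      have [[_ ZB _] _] := Fhom _ _ FZ Zq.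
      by exists Z => //; apply: ZB => //; apply: YZ.
    have [[_ YB _] _] := Fhom _ _ FY Yp.
    by exists Y => //; apply: YB => //; apply: ZY.
  by have [[_ _ Yf] _] := Fhom _ _ FY Yd; apply: Yf.
have [R [PR Rmax]] := Zorn_bigcup chain.
have [hR R0R] : partial_hom R /\ R0 `<=` R.
  case: PR => [Re|//]; exfalso; apply: (Rmax R0); last by right; split.
  split; rewrite Re // => R0e.
  by have [R00 _ _] := hR0; have := R0e _ R00.
have [R00 RB Rf] := hR.
have dom g : exists d, R (g, d).
  apply: contrapT => ng.
  have [d dP] := divisible_compatible_value g hR.
  pose R' : set (G * D) := [set p | exists q n, R q /\ p = q + (g, d) *~ n].
  have RR' : R `<=` R' by move=> q Rq; exists q, 0; rewrite mulr0z addr0.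
  have R'g : R' (g, d) by exists 0, 1; rewrite mulr1z add0r.
  apply: (Rmax R'); first by split=> // /(_ _ R'g) Rg; apply: ng; exists d.
  right; split; last exact: subset_trans RR'.
  split; first exact: RR'.
    move=> _ _ [p [n [Rp ->]]] [q [m [Rq ->]]].
    by exists (p - q), (n - m); split; [exact: RB | rewrite mulrzBr opprD addrACA].
  move=> e [[x e'] [n [Rx]]]; rewrite pairMz => -[/esym/eqP].
  rewrite addrC addr_eq0 => /eqP gx ->.
  have /dP -> : R (g *~ - n, e') by rewrite mulrNz gx opprK.
  by rewrite mulrNz addNr.
have [f fP] := choice dom.
have fD : additive f.
  move=> x y; have := RB _ _ (fP x) (fP y) => /(partial_hom_val hR (fP _)) <-//.
pose f' : {additive G -> D} := HB.pack f (GRing.isZmodMorphism.Build G D f fD).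
by exists f' => x d /R0R; apply: (partial_hom_val hR (fP x)).
Qed.

Hypothesis torD : forall n, (1 < n)%N -> exists d : D, d != 0 /\ d *+ n = 0.

(** A nonzero x can be sent to a nonzero d as soon as the order of x kills d;
    the map so defined on the multiples of x then extends to G. *)
Lemma hom_separation x : x != 0 -> exists f : {additive G -> D}, f x != 0.
Proof.
move=> x0.
have [d [d0 dP]] : exists d : D, d != 0 /\ forall n : int, x *~ n = 0 -> d *~ n = 0.
  have [ex|nex] := pselect (exists k, (0 < k)%N && (x *+ k == 0)).
    case: (ex_minnP ex) => k /andP[k0 /eqP xk] kmin.
    have k1 : (1 < k)%N.
      by case: k k0 xk {kmin} => [|[|k]]// _ xk; rewrite -[x]mulr1n xk eqxx in x0.
    have [d [d0 dk]] := torD k1; exists d; split=> // n xn.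
    have kz : k%:Z != 0 by rewrite -lt0n.
    have xr : x *~ (n %% k)%Z = 0.
      by rewrite modzE mulrzBr xn mulrC mulrzA -pmulrn xk mul0rz subrr.
    have r0 : (n %% k)%Z = 0.
      have := modz_ge0 n kz; have := ltz_mod n kz.
      case: (n %% k)%Z xr => // -[//|r] /eqP xr; rewrite ltz_nat absz_nat => rk _.
      by have := kmin r.+1 xr; rewrite leqNgt rk.
    by rewrite (divz_eq n k) r0 addr0 mulrC mulrzA -pmulrn dk mul0rz.
  (* An element of infinite order may be sent anywhere nonzero. *)
  have [d [d0 _]] := torD (isT : (1 < 2)%N); exists d; split=> // n.
  case: n => [[|k]|k]; first by rewrite mulr0z.
    by move=> /eqP xk; case: nex; exists k.+1.
  rewrite NegzE mulrNz => /eqP; rewrite oppr_eq0 => xk.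
  by case: nex; exists k.+1.
have [|f fP] := @hom_extension [set p | exists n : int, p = (x, d) *~ n].
  split; first by exists 0.
    by move=> _ _ [n ->] [m ->]; exists (n - m); rewrite mulrzBr.
  by move=> e [n]; rewrite pairMz => -[/esym/dP <-].
by exists f; rewrite (fP x d) //; exists 1.
Qed.

End HomExtension.

(** * Enough injective modules *)

Section Coinduced.
Variables (A : pzRingType) (D : zmodType) (I : Type).

(** The module of families, indexed by I, of additive maps A -> D. It is a
    power of the coinduced module Hom_Z(A, D), on which r acts by
    precomposition with left multiplication by r. *)
Definition coind := {h : I -> A -> D | forall i, additive (h i)}.
HB.instance Definition _ := gen_eqMixin coind.
HB.instance Definition _ := gen_choiceMixin coind.

Lemma coind_eq (g h : coind) : (forall i a, sval g i a = sval h i a) -> g = h.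
Proof.
by case: g h => g gD [h hD] /= e; apply/eq_exist/funext => i; apply/funext.
Qed.

Let zero : coind.
Proof. by exists (fun _ _ => 0) => i a b; rewrite subr0. Defined.
Let opp (h : coind) : coind.
Proof.
by exists (fun i a => - sval h i a) => i a b; rewrite (svalP h i) opprB opprK addrC.
Defined.
Let add (g h : coind) : coind.
Proof.
exists (fun i a => sval g i a + sval h i a) => i a b.
by rewrite (svalP g i) (svalP h i) opprD addrACA.
Defined.
Let scale (r : A^c) (h : coind) : coind.
Proof.
by exists (fun i a => sval h i ((r : A) * a)) => i a b; rewrite mulrBr (svalP h i).
Defined.

Let addA : associative add.
Proof. by move=> *; apply: coind_eq => i a; apply: addrA. Qed.
Let addC : commutative add.
Proof. by move=> *; apply: coind_eq => i a; apply: addrC. Qed.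
Let add0 : left_id zero add.
Proof. by move=> *; apply: coind_eq => i a; apply: add0r. Qed.
Let addN : left_inverse zero opp add.
Proof. by move=> *; apply: coind_eq => i a; apply: addNr. Qed.
HB.instance Definition _ := GRing.isZmodule.Build coind addA addC add0 addN.

Let scaleA a b h : scale a (scale b h) = scale (a * b) h.
Proof. by apply: coind_eq => i c /=; rewrite mulrA. Qed.
Let scale1 : left_id 1 scale.
Proof. by move=> h; apply: coind_eq => i c /=; rewrite mul1r. Qed.
Let scaleDr : right_distributive scale +%R.
Proof. by move=> a g h; apply: coind_eq. Qed.
Let coind_additive (h : coind) i a b : sval h i (a + b) = sval h i a + sval h i b.
Proof.
have h0 : sval h i 0 = 0 by rewrite -[X in sval h i X](subrr 0) (svalP h i) subrr.
have hN c : sval h i (- c) = - sval h i c.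
  by rewrite -[- c]sub0r (svalP h i) h0 sub0r.
by rewrite -[X in a + X]opprK (svalP h i) hN opprK.
Qed.
Let scaleDl h : {morph scale^~ h : a b / a + b}.
Proof. by move=> a b; apply: coind_eq => i c /=; rewrite mulrDl coind_additive. Qed.
HB.instance Definition _ :=
  GRing.Zmodule_isLmodule.Build A^c coind scaleA scale1 scaleDr scaleDl.

(** One half of the adjunction with the forgetful functor to abelian groups:
    a family of additive maps M -> D is an A-linear map M -> coind. *)
Lemma coind_map (M : rmodType A) (k : I -> {additive M -> D}) :
  exists f : {linear M -> coind},
    forall m i a, sval (f m) i a = k i ((a : A^c) *: m).
Proof.
have kD m i : additive (fun a : A => k i ((a : A^c) *: m)).
  by move=> a b; rewrite scalerBl raddfB.
pose f m : coind := exist _ (fun i a => k i ((a : A^c) *: m)) (kD m).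
have lf : linear f.
  by move=> r m n; apply: coind_eq => i a /=; rewrite scalerDr raddfD scalerA.
by exists (mk_linear lf).
Qed.

(** Evaluating at 1 turns h into a family of additive maps into D; these extend
    along g because D is divisible, and the extensions form an A-linear map. *)
Lemma coind_injective (divD : forall n (d : D), (0 < n)%N -> exists e, e *+ n = d)
    (M N Q : rmodType A) (f : {linear M -> N}) (g : {linear N -> Q})
    (h : {linear N -> coind}) :
  exact_at f g -> (forall m, h (f m) = 0) ->
  exists k : {linear Q -> coind}, forall n, h n = k (g n).
Proof.
move=> fg hf.
have ext i : exists k : {additive Q -> D}, forall n, k (g n) = sval (h n) i 1.
  have [|k kP] := @hom_extension Q D divD
      [set p | exists n, p = (g n, sval (h n) i 1)]%classic.
  - split=> [|_ _ [m ->] [n ->]|d [n [/esym/fg[m <-] ->]]]; last by rewrite hf.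
      by exists 0; rewrite !linear0.
    by exists (m - n); rewrite !linearB.
  by exists k => n; apply: kP; exists n.
have [k kP] := choice ext; have [k' k'P] := coind_map k.
exists k' => n; apply: coind_eq => i a.
by rewrite k'P -linearZ kP linearZ /= mulr1.
Qed.

End Coinduced.

(** Homomorphisms to Q/Z separate the points of M, so M embeds in the module
    coinduced from Q/Z and indexed by all of them. *)
Lemma injective_embedding (A : pzRingType) (M : rmodType A) :
  exists (E : rmodType A) (e : {linear M -> E}), injective e /\
    forall (N P Q : rmodType A) (f : {linear N -> P}) (g : {linear P -> Q})
      (h : {linear P -> E}), exact_at f g -> (forall m, h (f m) = 0) ->
    exists k : {linear Q -> E}, forall n, h n = k (g n).
Proof.
have [D [divD torD]] := divisible_torsion_exists.
have [e eP] := @coind_map A D {additive M -> D} M id.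
exists (coind A D {additive M -> D}), e; split; last exact: coind_injective.
apply: linear_inj0 => x ex; apply: contrapT => /eqP x0.
have [f /eqP[]] := hom_separation divD torD x0.
by rewrite -[x]scale1r -(eP x f 1) ex.
Qed.

(** * Relative injective dimension and coresolutions *)

Section ExtDimension.
Variable A : pzRingType.
Implicit Types (X : rmod_class A) (L M N Q E : rmodType A).

(** The injective dimension of M relative to X; at n = 0 it is [Ext_perp X M]
    by conversion. *)
Definition injdim_le X n M : Prop :=
  forall i F, (n < i)%N -> X F -> Ext_vanishes i F M.

Lemma injdim_le_mono X m n M : (m <= n)%N -> injdim_le X m M -> injdim_le X n M.
Proof. by move=> mn h i F ni; apply/h/(leq_ltn_trans mn). Qed.

Section ShortExact.
Variables (M N Q : rmodType A) (u : {linear M -> N}) (v : {linear N -> Q}).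
Hypothesis uv : short_exact u v.

Let uI : injective u. Proof. by case: uv. Qed.
Let vS : surj v. Proof. by case: uv. Qed.
Let uvE : exact_at u v. Proof. by case: uv. Qed.
Let vu x : v (u x) = 0. Proof. by apply/uvE; exists x. Qed.

Let lift_ker (P : rmodType A) (f : {linear P -> N}) :
  (forall x, v (f x) = 0) -> exists k : {linear P -> M}, u \o k =1 f.
Proof. by move=> vf; apply: lift_inj => // x; apply/uvE. Qed.

Lemma pr_diffK (F : rmodType A) (P : proj_resolution F) n x :
  pr_diff P n (pr_diff P n.+1 x) = 0.
Proof. by apply/(@pr_exact _ _ P n); exists x. Qed.

(** The next three lemmas are parts of the long exact sequence for Ext^i(F, -).
    They hold for each projective resolution P of F separately: the modules P_i
    being projective, Hom(P, -) turns a short exact sequence of modules into one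
    of cochain complexes, which is then chased. *)
Lemma injdim_le_mid X n : injdim_le X n M -> injdim_le X n Q -> injdim_le X n N.
Proof.
move=> hM hQ [//|i] F ni XF P f fd.
have [|g gP] := hQ i.+1 F ni XF P (v \o f : {linear _ -> _}).
  by move=> x /=; rewrite fd linear0.
have [g' g'P] := @pr_proj _ _ P i _ _ _ g vS.
have [x|k kP] := @lift_ker _ (f \- (g' \o pr_diff P i) : {linear _ -> _}).
  by rewrite /= linearB [v (f _)]gP [v (g' _)]g'P subrr.
have [|l lP] := hM i.+1 F ni XF P k.
  by move=> x; apply: uI; rewrite [LHS]kP /= fd pr_diffK [g' 0]linear0 subrr linear0.
exists (g' \+ (u \o l)  : {linear _ -> _}) => x /=.
by rewrite -lP [u _]kP /= addrC subrK.
Qed.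

Lemma injdim_le_sub X n : injdim_le X n.+1 N -> injdim_le X n Q -> injdim_le X n.+1 M.
Proof.
move=> hN hQ [//|[//|i]] F ni XF P f fd.
have [|g gP] := hN i.+2 F ni XF P (u \o f : {linear _ -> _}).
  by move=> x /=; rewrite fd linear0.
have [|h hP] := hQ i.+1 F ni XF P (v \o g : {linear _ -> _}).
  by move=> x /=; rewrite -gP /= vu.
have [h' h'P] := @pr_proj _ _ P i _ _ _ h vS.
have [x|k kP] := @lift_ker _ (g \- (h' \o pr_diff P i) : {linear _ -> _}).
  by rewrite /= linearB [v (g _)]hP [v (h' _)]h'P subrr.
exists k => x; apply: uI; rewrite [RHS]kP /= pr_diffK linear0 subr0.
exact: gP.
Qed.

Lemma injdim_le_quot X n : injdim_le X n N -> injdim_le X n.+1 M -> injdim_le X n Q.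
Proof.
move=> hN hM [//|i] F ni XF P f fd.
have [f' f'P] := @pr_proj _ _ P i.+1 _ _ _ f vS.
have [x|k kP] := @lift_ker _ (f' \o pr_diff P i.+1 : {linear _ -> _}).
  by rewrite /= [v _]f'P fd.
have [|l lP] := hM i.+2 F ni XF P k.
  by move=> x; apply: uI; rewrite [LHS]kP /= pr_diffK !linear0.
have [|m mP] := hN i.+1 F ni XF P (f' \- (u \o l) : {linear _ -> _}).
  by move=> x; rewrite /= -lP [u _]kP /= subrr.
exists (v \o m : {linear _ -> _}) => x /=.
by rewrite -mP /= linearB vu subr0 [RHS]f'P.
Qed.

End ShortExact.

Lemma linear_inverse M N (f : {linear M -> N}) : bijective f ->
  exists g : {linear N -> M}, cancel f g /\ cancel g f.
Proof.
case=> g fK gK; have lg : linear g.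
  by move=> a x y; apply: (can_inj fK); rewrite gK linearP !gK.
by exists (mk_linear lg).
Qed.

Lemma iso_rmod_sym M N : iso_rmod M N -> iso_rmod N M.
Proof. by case=> f /linear_inverse[g [fK gK]]; exists g, f. Qed.

Lemma injdim_le_iso X n M N : iso_rmod M N -> injdim_le X n M -> injdim_le X n N.
Proof.
case=> f /linear_inverse[g [fK gK]] hM [//|i] F ni XF P h hd.
have [|k kP] := hM i.+1 F ni XF P (g \o h : {linear _ -> _}).
  by move=> x /=; rewrite hd linear0.
by exists (f \o k : {linear _ -> _}) => x /=; rewrite -kP /= gK.
Qed.

(** An injective module has no Ext^i for i > 0, whatever the resolution: a
    cocycle vanishes on a boundary, so it extends along the next differential. *)
Lemma enough_Ext_perp X M : exists (E Q : rmodType A) (e : {linear M -> E})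
  (q : {linear E -> Q}), short_exact e q /\ Ext_perp X E.
Proof.
have [E [e [eI Einj]]] := injective_embedding M.
have [Q [q [eq qS]]] := cokernel_exists e.
exists E, Q, e, q; split=> // -[//|i] F _ _ P f fd.
apply: (Einj _ _ _ (pr_diff P i.+1) (pr_diff P i) f) => //.
exact: pr_exact.
Qed.

Section Coresolutions.
Variable Y : rmod_class A.

Lemma zero_module_exists : exists Z : rmodType A, forall z : Z, z = 0.
Proof.
have [Z [q [qE qS]]] := cokernel_exists (idfun : {linear A^c^o -> A^c^o}).
by exists Z => z; have [x <-] := qS z; apply/qE; exists x.
Qed.

Definition zero_map M N : {linear M -> N} := \0.

Lemma has_coresolution0 M : Y M -> has_coresolution Y 0 M.
Proof.
move=> YM; have [Z Z0] := zero_module_exists.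
pose X i := if i is 0%N then M else Z.
exists X, (fun i => @zero_map (X i) (X i.+1)), (idfun : {linear M -> M}).
split=> //.
- by move=> x; split=> // _; exists x.
- move=> i x; split=> // _; exists 0; rewrite linear0; exact/esym/Z0.
- by case.
- by case=> // i _; apply: Z0.
Qed.

Lemma has_coresolutionS n M E Q (e : {linear M -> E}) (q : {linear E -> Q}) :
  short_exact e q -> Y E -> has_coresolution Y n Q ->
  has_coresolution Y n.+1 M.
Proof.
move=> [eI eq qS] YE [X [d [f [fI fE dE YX X0]]]].
pose X' i := if i is j.+1 then X j else E.
pose d' i : {linear X' i -> X' i.+1} :=
  match i with 0%N => f \o q : {linear _ -> _} | j.+1 => d j end.
exists X', d', e; split=> //.
- by move=> x; rewrite -eq /=; split=> [|->]; rewrite ?linear0// -[0](linear0 f) => /fI.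
- case=> [|i] /=; last exact: dE.
  move=> x; rewrite fE; split=> [[y <-]|[y <-]]; last by exists (q y).
  by have [z <-] := qS y; exists z.
- by case=> [|i] //; apply: YX.
- by case=> [|i] //; apply: X0.
Qed.

Lemma has_coresolution0_inv M : has_coresolution Y 0 M ->
  exists2 N, Y N & iso_rmod N M.
Proof.
move=> [X [d [e [eI eE dE YX X0]]]]; exists (X 0%N); first exact: YX.
apply: iso_rmod_sym; exists e.
have /choice[g gP] x : exists y, e y = x by apply/eE/X0.
by exists g => x //; apply: eI.
Qed.

Lemma has_coresolutionS_inv n M : has_coresolution Y n.+1 M ->
  exists E Q (e : {linear M -> E}) (q : {linear E -> Q}),
    [/\ short_exact e q, Y E & has_coresolution Y n Q].
Proof.
move=> [X [d [e [eI eE dE YX X0]]]].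
have [Q [q [k [qS kI kq]]]] := image_factorization (d 0%N).
exists (X 0%N), Q, e, q; split; [split=> //| exact: YX|].
  move=> x; rewrite -eE -kq /=; split=> [->|]; first by rewrite linear0.
  by rewrite -[0](linear0 k) => /kI.
exists (X \o S), (fun i => d i.+1), k; split=> //.
- move=> x; rewrite dE; split=> [[y <-]|[y <-]]; first by exists (q y); rewrite -kq.
  by have [z <-] := qS y; exists z; rewrite -kq.
- by move=> i; apply: dE.
- by move=> i ni; apply: YX.
- by move=> i ni; apply: X0.
Qed.

End Coresolutions.

(** Coresolutions are peeled off or built one term at a time; for the converse
    each cokernel of an injective embedding has dimension one less. *)
Lemma has_coresolution_Ext_perp X n M :
  has_coresolution (Ext_perp X) n M <-> injdim_le X n M.
Proof.
split; elim: n M => [|n IH] M.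
- by move=> /has_coresolution0_inv[N YN NM]; apply: (injdim_le_iso NM).
- move=> /has_coresolutionS_inv[E [Q [e [q [eq YE /IH hQ]]]]].
  apply: (injdim_le_sub eq _ hQ); exact: injdim_le_mono YE.
- exact: has_coresolution0.
move=> hM; have [E [Q [e [q [eq YE]]]]] := enough_Ext_perp X M.
apply: (has_coresolutionS eq YE); apply: IH.
by apply: (injdim_le_quot eq _ hM); apply: injdim_le_mono YE.
Qed.

Lemma least_le (P : nat -> Prop) n :
  (least P <= Some n)%enat <-> exists2 m, (m <= n)%N & P m.
Proof.
rewrite /least; case: pselect => [exP|nP] /=; last first.
  by split=> // -[m _ Pm]; case: nP; exists m; apply/asboolP.
case: ex_minnP => m /asboolP Pm mmin; split=> [mn|[k kn Pk]]; first by exists m.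
by apply: leq_trans kn; apply/mmin/asboolP.
Qed.

Lemma cotdim_le n M : (cotdim M <= Some n)%enat <-> injdim_le (@flat A) n M.
Proof.
rewrite /cotdim least_le; split=> [[m mn /has_coresolution_Ext_perp]|h].
  exact: injdim_le_mono.
by exists n => //; apply/has_coresolution_Ext_perp.
Qed.

Lemma cotdim_class_le X n :
  (cotdim_class X <= Some n)%enat <-> forall M, X M -> injdim_le (@flat A) n M.
Proof.
rewrite /cotdim_class least_le; split=> [[m mn h] M /h /cotdim_le|h].
  exact: injdim_le_mono.
by exists n => // M /h /cotdim_le.
Qed.

End ExtDimension.

(** * Adjoint functors between module categories *)

Section Functoriality.
Variables (A B : pzRingType) (F : rmod_functor A B).

Lemma fmap_compE (M N Q : rmodType A) (g : {linear N -> Q}) (f : {linear M -> N})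
    (h : {linear M -> Q}) : h =1 g \o f -> fmap F h =1 fmap F g \o fmap F f.
Proof.
move=> hgf; rewrite (_ : h = (g \o f : {linear M -> Q})); last exact: linear_ext.
exact: fmap_comp.
Qed.

Lemma fmap_idE (M : rmodType A) (f : {linear M -> M}) : f =1 id -> fmap F f =1 id.
Proof.
move=> fid; rewrite (_ : f = (idfun : {linear M -> M})); last exact: linear_ext.
exact: fmap_id.
Qed.

Hypothesis Fadd : additive_functor F.

Lemma fmap_eq0 (M N : rmodType A) (f : {linear M -> N}) :
  (forall x, f x = 0) -> forall x, fmap F f x = 0.
Proof.
move=> f0 x; have := Fadd f f x.
rewrite (_ : (f \+ f : {linear M -> N}) = f); last first.
  by apply: linear_ext => y /=; rewrite f0 addr0.
by move=> /= /(congr1 (fun y => y - fmap F f x)); rewrite subrr addrK.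
Qed.

End Functoriality.

(** The regular module represents the forgetful functor, which lets elements of
    R N be transposed to maps out of a left adjoint. *)
Lemma linear_at (R : pzRingType) (U : lmodType R) (x : U) :
  exists f : {linear R^o -> U}, forall a : R, f a = a *: x.
Proof.
have lf : linear (fun a : R^o => (a : R) *: x).
  by move=> a b c; rewrite scalerDl scalerA.
by exists (mk_linear lf).
Qed.

Section Adjunctions.
Variables (A B : pzRingType) (L : rmod_functor A B) (R : rmod_functor B A).
Variable adj : adjunction L R.
Implicit Types (M : rmodType A) (N : rmodType B).
Local Notation eta := (adj_unit adj).
Local Notation eps := (adj_counit adj).

Definition transp (M : rmodType A) (N : rmodType B) (g : {linear L M -> N}) :
  {linear M -> R N} := fmap R g \o eta M.

Definition untransp (M : rmodType A) (N : rmodType B) (f : {linear M -> R N}) :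
  {linear L M -> N} := eps N \o fmap L f.

Lemma transpK M N (g : {linear L M -> N}) : untransp (transp g) =1 g.
Proof.
move=> x; rewrite /= (@fmap_compE _ _ L _ _ _ (fmap R g) (eta M)) //=.
by rewrite -[LHS](adj_counit_nat adj g) /= [eps _ _](adj_triangleL adj).
Qed.

Lemma untranspK M N (f : {linear M -> R N}) : transp (untransp f) =1 f.
Proof.
move=> x; rewrite /= (@fmap_compE _ _ R _ _ _ (eps N) (fmap L f)) //=.
by rewrite -[fmap R (fmap L f) _](adj_unit_nat adj f) [LHS](adj_triangleR adj).
Qed.

Lemma transp_comp (M M' : rmodType A) N (g : {linear L M' -> N}) (f : {linear M -> M'}) :
  transp (g \o fmap L f : {linear _ -> _}) =1 transp g \o f.
Proof.
move=> x; rewrite /= (@fmap_compE _ _ R _ _ _ g (fmap L f)) //=.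
by rewrite -[fmap R (fmap L f) _](adj_unit_nat adj f).
Qed.

Lemma untransp_comp M (N N' : rmodType B) (g : {linear N -> N'}) (f : {linear M -> R N}) :
  untransp (fmap R g \o f : {linear _ -> _}) =1 g \o untransp f.
Proof.
move=> x; rewrite /= (@fmap_compE _ _ L _ _ _ (fmap R g) f) //=.
by rewrite -[LHS](adj_counit_nat adj g).
Qed.

Hypotheses (Ladd : additive_functor L) (Radd : additive_functor R).

Lemma transp_eq0 M N (g : {linear L M -> N}) :
  (forall x, g x = 0) <-> (forall x, transp g x = 0).
Proof.
split=> h x; first exact: fmap_eq0.
by rewrite -transpK /= (@fmap_eq0 _ _ L) // linear0.
Qed.

Lemma untransp_eq0 M N (f : {linear M -> R N}) :
  (forall x, f x = 0) <-> (forall x, untransp f x = 0).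
Proof.
rewrite transp_eq0; split=> h x; first by rewrite untranspK.
by rewrite -untranspK.
Qed.

(** A map is surjective when the projection q to its cokernel vanishes; for a
    map in the image of L this can be tested on the transpose of q. *)
Lemma left_adjoint_surj (M N : rmodType A) (f : {linear M -> N}) :
  surj f -> surj (fmap L f).
Proof.
move=> fS; have [Q [q [fq _]]] := cokernel_exists (fmap L f).
move=> y; apply/fq; move: y; apply/transp_eq0 => x.
have [z <-] := fS x; move: z; rewrite -[forall z, _]/(forall z, (transp q \o f) z = 0).
move=> z; rewrite -transp_comp; move: z; apply/transp_eq0 => z /=.
by apply/fq; exists z.
Qed.

(** An element x of R M is a map out of the regular module; its transpose is
    killed by f, hence vanishes. *)
Lemma right_adjoint_inj (M N : rmodType B) (f : {linear M -> N}) :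
  injective f -> injective (fmap R f).
Proof.
move=> fI; apply: linear_inj0 => x fx; have [l lx] := linear_at x.
rewrite -[x]scale1r -lx; move: (1 : A^c^o); apply/untransp_eq0 => y.
apply: fI; rewrite linear0 -[LHS]/((f \o untransp l) y) -untransp_comp.
by move: y; apply/untransp_eq0 => a; rewrite /= lx linearZ /= fx scaler0.
Qed.

Lemma right_adjoint_exact (M N Q : rmodType B)
    (f : {linear M -> N}) (g : {linear N -> Q}) :
  injective f -> exact_at f g -> exact_at (fmap R f) (fmap R g).
Proof.
move=> fI fg y; split=> [gy|[x <-]]; last first.
  rewrite -[LHS]/((fmap R g \o fmap R f) x) -(@fmap_compE _ _ R _ _ _ g f (g \o f)) //.
  by apply: (fmap_eq0 Radd) => z; apply/fg; exists z.
have [l ly] := linear_at y.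
have [x|k kP] := lift_inj (f := untransp l) fI.
  apply/fg; rewrite -[LHS]/((g \o untransp l) x) -untransp_comp.
  by move: x; apply/untransp_eq0 => a; rewrite /= ly linearZ /= gy scaler0.
exists (transp k (1 : A^c^o)); rewrite -[y]scale1r -ly -[RHS]untranspK /=.
by rewrite (@fmap_compE _ _ R _ _ _ f k) // => z; rewrite -kP.
Qed.

(** Fullness of L gives s with L s the counit at L M, and s inverts the unit by
    the triangle identities. *)
Lemma unit_bijective M : fully_faithful L -> bijective (eta M).
Proof.
move=> Lff; have [inv _ invL] := Lff (R (L M)) M.
pose s := inv (eps (L M)); have sE : fmap L s = eps (L M) by apply: invL.
have sK : (s \o eta M : {linear M -> M}) = idfun.
  apply: (bij_inj (Lff M M)); apply: linear_ext => x; rewrite fmap_comp sE fmap_id.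
  exact: adj_triangleL.
exists s => x; first by rewrite -[LHS]/((s \o eta M : {linear M -> M}) x) sK.
rewrite -[LHS]/((eta M \o s) x) (adj_unit_nat adj s) sE.
exact: adj_triangleR.
Qed.

Lemma counit_bijective N : fully_faithful R -> bijective (eps N).
Proof.
move=> Rff; have [inv _ invR] := Rff N (L (R N)).
pose s := inv (eta (R N)); have sE : fmap R s = eta (R N) by apply: invR.
have sK : (eps N \o s : {linear N -> N}) = idfun.
  apply: (bij_inj (Rff N N)); apply: linear_ext => x; rewrite fmap_comp sE fmap_id.
  exact: adj_triangleR.
exists s => x; last by rewrite -[LHS]/((eps N \o s : {linear N -> N}) x) sK.
rewrite -[LHS]/((s \o eps N) x) (adj_counit_nat adj s) sE.
exact: adj_triangleL.
Qed.
End Adjunctions.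

Lemma exact_of_adjoints (A B : pzRingType) (L R : rmod_functor B A)
    (F : rmod_functor A B) :
  additive_functor F -> additive_functor L -> additive_functor R ->
  adjunction L F -> adjunction F R -> exact_functor F.
Proof.
move=> Fadd Ladd Radd LF FR M N Q f g [fI fg gS]; split.
- exact: (right_adjoint_inj LF Ladd Fadd fI).
- exact: (right_adjoint_exact LF Ladd Fadd fI fg).
- exact: (left_adjoint_surj FR Fadd Radd gS).
Qed.

(** Induction on k: embed Z in a module of dimension 0, whose cokernel has
    dimension one less, and apply F to this short exact sequence. *)
Lemma injdim_le_functor (A B : pzRingType) (F : rmod_functor A B)
    (XA : rmod_class A) (XB : rmod_class B) m k Z :
  exact_functor F -> (forall Y, Ext_perp XA Y -> injdim_le XB m (F Y)) ->
  injdim_le XA k Z -> injdim_le XB (k + m) (F Z).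
Proof.
move=> Fex Fm; elim: k Z => [|k IH] Z hZ; first exact: Fm.
have [E [Q [e [q [eq EX]]]]] := enough_Ext_perp XA Z.
have hE := Fm _ EX; have hQ : injdim_le XA k Q.
  by apply: (injdim_le_quot eq _ hZ); apply: injdim_le_mono EX.
rewrite addSn; apply: (injdim_le_sub (Fex _ _ _ _ _ eq) _ (IH _ hQ)).
by apply: injdim_le_mono hE; rewrite -addSn leq_addl.
Qed.

(** * Projective covers *)

Section SuperfluousKernel.
Variables (A : pzRingType) (P M : rmodType A) (p : {linear P -> M}).

(** The categorical form of superfluous kernels, stable under transport along
    adjunctions: p is an essential epimorphism. *)
Lemma superfluous_kerP : surj p -> superfluous_ker p <->
  forall (K : rmodType A) (k : {linear K -> P}), surj (p \o k) -> surj k.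
Proof.
move=> pS; split=> [sup K k pk y|ess L [L0 LP] LS x].
  apply/asboolP; apply: (sup (fun x => `[< exists z, k z = x >])).
    split; first by apply/asboolP; exists 0; rewrite linear0.
    move=> a _ _ /asboolP[x <-] /asboolP[z <-].
    by apply/asboolP; exists (a *: x + z); rewrite linearP.
  move=> x; have [z pz] := pk (p x).
  exists (x - k z), (k z); split; first by rewrite linearB [p (k z)]pz subrr.
    by apply/asboolP; exists z.
  by rewrite subrK.
have [K [k [_ kL]]] := @submodule_exists _ P (fun x => x \in L) L0 LP.
apply/kL/ess => y; have [z <-] := pS y; have [w [l [pw /kL[u <-] ->]]] := LS z.
by exists u; rewrite linearD pw add0r.
Qed.

End SuperfluousKernel.

(** * Recollements *)

Section Recollement.
Variables (A B C : pzRingType) (r : recollement A B C).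

Local Notation i_ := (i_low r).
Local Notation i' := (i_up r).
Local Notation j' := (j_up r).
Local Notation j_ := (j_low r).
Local Notation j_s := (j_shriek r).

Lemma i_low_exact : exact_functor (i_low r).
Proof.
exact: (exact_of_adjoints (@i_low_additive _ _ _ r) (@i_up_additive _ _ _ r)
  (@i_shriek_additive _ _ _ r) (adj_i_up_low r) (adj_i_low_shriek r)).
Qed.

Lemma j_up_exact : exact_functor (j_up r).
Proof.
exact: (exact_of_adjoints (@j_up_additive _ _ _ r) (@j_shriek_additive _ _ _ r)
  (@j_low_additive _ _ _ r) (adj_j_shriek_up r) (adj_j_up_low r)).
Qed.

Lemma j_up_surj (M N : rmodType B) (f : {linear M -> N}) :
  surj f -> surj (fmap j' f).
Proof.
exact: (left_adjoint_surj (adj_j_up_low r) (@j_up_additive _ _ _ r)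
  (@j_low_additive _ _ _ r)).
Qed.

Lemma j_up_inj (M N : rmodType B) (f : {linear M -> N}) :
  injective f -> injective (fmap j' f).
Proof.
exact: (right_adjoint_inj (adj_j_shriek_up r) (@j_shriek_additive _ _ _ r)
  (@j_up_additive _ _ _ r)).
Qed.

Lemma j_up_low_iso (N : rmodType C) : iso_rmod (j' (j_ N)) N.
Proof.
exists (adj_counit (adj_j_up_low r) N); exact: counit_bijective (j_low_ff r).
Qed.

Lemma i_shriek_low_iso (N : rmodType A) : iso_rmod (i_shriek r (i_ N)) N.
Proof.
apply: iso_rmod_sym; exists (adj_unit (adj_i_low_shriek r) N).
exact: unit_bijective (i_low_ff r).
Qed.

Lemma fkernel_sub (K M : rmodType B) (k : {linear K -> M}) :
  injective k -> (forall x, fmap j' k x = 0) -> fkernel j' K.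
Proof.
move=> kI k0 x; apply: (j_up_inj kI); by rewrite k0 linear0.
Qed.

Lemma fkernel_coker (M N Q : rmodType B) (f : {linear M -> N}) (q : {linear N -> Q}) :
  exact_at f q -> surj q -> surj (fmap j' f) -> fkernel j' Q.
Proof.
move=> fq qS fS x; have [y <-] := j_up_surj qS x; have [z <-] := fS y.
rewrite -[LHS]/((fmap j' q \o fmap j' f) z) -(@fmap_compE _ _ j' _ _ _ q f (q \o f)) //.
by apply: (fmap_eq0 (@j_up_additive _ _ _ r)) => t; apply/fq; exists t.
Qed.

(** The unit M -> j_* j^* M is inverted by j^*, since the counit of the fully
    faithful j_* is an isomorphism. *)
Lemma j_up_unit (M : rmodType B) :
  bijective (fmap j' (adj_unit (adj_j_up_low r) M)).
Proof.
have [g epsK gK] := counit_bijective (adj_j_up_low r) (j' M) (j_low_ff r).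
exists (adj_counit (adj_j_up_low r) (j' M)) => x.
  exact: (adj_triangleL (adj_j_up_low r) x).
by apply: (can_inj epsK); exact: (adj_triangleL (adj_j_up_low r)).
Qed.

Section Bound.
Variables (X' : rmod_class A) (X : rmod_class B) (X'' : rmod_class C) (a c m : nat).
Hypothesis hA : forall Z, injdim_le X' a Z.
Hypothesis hC : forall Z, injdim_le X'' c Z.
Hypothesis hi : forall Y, Ext_perp X' Y -> injdim_le X m (i_ Y).
Hypothesis hj : forall Y, Ext_perp X'' Y -> injdim_le X m (j_ Y).

Lemma injdim_le_fkernel W : fkernel j' W -> injdim_le X (a + m) W.
Proof.
move=> /im_i_low_ker_j_up[Z _ ZW]; apply: (injdim_le_iso ZW).
exact: injdim_le_functor i_low_exact hi (hA Z).
Qed.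

(** With 0 -> N -> E -> Q -> 0 and E of dimension 0, let J be the image of
    j_* E -> j_* Q. Its cokernel W is killed by j^*, so
    0 -> J -> j_* Q -> W -> 0 bounds J, and 0 -> j_* N -> j_* E -> J -> 0 bounds
    j_* N. The term a + m comes from W; the summand 1 pays for passing from W
    to J. *)
Lemma injdim_le_j_low k N : injdim_le X'' k N -> injdim_le X (a + k + m + 1) (j_ N).
Proof.
elim: k N => [|k IH] N hN.
  by apply: injdim_le_mono (hj hN); rewrite addn0 addnAC leq_addl.
have [E [Q [e [q [eq EX]]]]] := enough_Ext_perp X'' N.
have hQ : injdim_le X'' k Q.
  by apply: (injdim_le_quot eq _ hN); apply: injdim_le_mono EX.
have [eI exq qS] := eq.
have [J [p [l [pS lI lp]]]] := image_factorization (fmap j_ q).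
have [W [w [lw wS]]] := cokernel_exists l.
have hW : injdim_le X (a + m) W.
  apply: injdim_le_fkernel; apply: (fkernel_coker lw wS) => y.
  have [g epsK gK] := counit_bijective (adj_j_up_low r) Q (j_low_ff r).
  have [h _ hK] := counit_bijective (adj_j_up_low r) E (j_low_ff r).
  have [z zE] := qS (adj_counit (adj_j_up_low r) Q y).
  exists (fmap j' p (h z)).
  rewrite -[LHS]/((fmap j' l \o fmap j' p) (h z)).
  rewrite -(@fmap_compE _ _ j' _ _ _ l p (fmap j_ q)); last by move=> x; rewrite lp.
  apply: (can_inj epsK); rewrite -zE -{2}(hK z).
  exact/esym/(adj_counit_nat (adj_j_up_low r) q).
have hJ : injdim_le X (a + k + m + 1) J.
  have lwE : short_exact l w by [].
  rewrite addn1; apply: (injdim_le_sub lwE); first by rewrite -addn1; apply: IH.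
  by apply: injdim_le_mono hW; rewrite addnAC leq_addr.
have seq : short_exact (fmap j_ e) p.
  split=> //.
    exact: (right_adjoint_inj (adj_j_up_low r) (@j_up_additive _ _ _ r)
      (@j_low_additive _ _ _ r)).
  have := right_adjoint_exact (adj_j_up_low r) (@j_up_additive _ _ _ r)
    (@j_low_additive _ _ _ r) eI exq.
  move=> h x; rewrite -h -lp /=; split=> [->|]; first by rewrite linear0.
  by rewrite -[0](linear0 l) => /lI.
rewrite addn1 in hJ; rewrite addn1 addnS addSn; apply: (injdim_le_sub seq _ hJ).
by apply: injdim_le_mono (hj EX); rewrite -!addSn leq_addl.
Qed.

(** Here K and W are the kernel and the cokernel of M -> j_* j^* M, both killed
    by j^*, and J is its image. *)
Lemma injdim_le_recollement M : injdim_le X (a + c + m + 1) M.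
Proof.
pose eta := adj_unit (adj_j_up_low r) M.
have [eta' etaK etaK'] := j_up_unit M.
have [K [k [kI kE]]] := kernel_exists eta.
have [J [p [l [pS lI lp]]]] := image_factorization eta.
have [W [w [lw wS]]] := cokernel_exists l.
have hK : injdim_le X (a + m) K.
  apply: injdim_le_fkernel; apply: (fkernel_sub kI) => x; apply: (can_inj etaK).
  rewrite linear0 -[LHS]/((fmap j' eta \o fmap j' k) x).
  rewrite -(@fmap_compE _ _ j' _ _ _ eta k (eta \o k)) //.
  by apply: (fmap_eq0 (@j_up_additive _ _ _ r)) => t; apply/kE; exists t.
have hW : injdim_le X (a + m) W.
  apply: injdim_le_fkernel; apply: (fkernel_coker lw wS) => y.
  exists (fmap j' p (eta' y)); rewrite -[LHS]/((fmap j' l \o fmap j' p) (eta' y)).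
  rewrite -(@fmap_compE _ _ j' _ _ _ l p eta); first exact: etaK'.
  by move=> x; rewrite lp.
have hJ : injdim_le X (a + c + m + 1) J.
  rewrite addn1; apply: (@injdim_le_sub _ _ _ _ l w) => //.
    by rewrite -addn1; apply: injdim_le_j_low.
  by apply: injdim_le_mono hW; rewrite addnAC leq_addr.
apply: (@injdim_le_mid _ _ _ _ k p) => //.
  split=> // x; rewrite -kE -lp /=; split=> [->|]; first by rewrite linear0.
  by rewrite -[0](linear0 l) => /lI.
by apply: injdim_le_mono hK; rewrite -!addnA leq_add2l addnCA leq_addr.
Qed.

End Bound.

(** Let p : Q -> j_! N be a projective cover. A map k : K -> j^* Q that becomes
    surjective onto N has a transpose j_! K -> Q that becomes surjective onto
    j_! N, hence is surjective. Applying j^* to it gives surjectivity of k; the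
    case K = j^* Q shows that the counit j_! j^* Q -> Q is surjective, hence
    split, which makes j^* Q projective. *)
Lemma right_perfect_of_j_shriek : right_perfect B -> right_perfect C.
Proof.
pose adj := adj_j_shriek_up r.
pose eta := adj_unit adj; pose eps := adj_counit adj.
have etaB N : bijective (eta N) by apply: unit_bijective (j_shriek_ff r).
have jsS := left_adjoint_surj adj (@j_shriek_additive _ _ _ r) (@j_up_additive _ _ _ r).
move=> perf N; have [Q [p [projQ pS psup]]] := perf (j_s N).
have [etaN' [etaNK etaNK']] := linear_inverse (etaB N).
pose p' : {linear j' Q -> N} := etaN' \o fmap j' p.
have p'S : surj p'.
  by move=> y; have [x xE] := j_up_surj pS (eta N y); exists x; rewrite /= xE etaNK.
have ess (K : rmodType C) (k : {linear K -> j' Q}) :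
    surj (p' \o k) -> surj (untransp adj k).
  move=> kS; apply: ((superfluous_kerP pS).1 psup) => y.
  have [x <-] := jsS _ _ (p' \o k : {linear _ -> _}) kS y.
  exists x; rewrite -untransp_comp.
  rewrite /= (@fmap_compE _ _ j_s _ _ _ (eta N) (p' \o k)); last first.
    by move=> z; rewrite /= etaNK'.
  exact: (adj_triangleL adj).
exists (j' Q), p'; split=> //; last first.
  apply/superfluous_kerP => // K k /ess kS y.
  have [x <-] := j_up_surj kS y; have [etaK' etaKK etaKK'] := etaB K.
  exists (etaK' x); rewrite -[LHS](untranspK adj k) /=.
  by rewrite -[in LHS]/eta -/(eta K) etaKK'.
have epsS : surj (untransp adj (idfun : {linear j' Q -> j' Q})).
  by apply: ess => y; have [x <-] := p'S y; exists x.
have [s sE] := projQ _ _ _ (idfun : {linear Q -> Q}) epsS.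
have jsE x : fmap j' s x = eta (j' Q) x.
  (* Both j^* s and the unit are right inverses of the injective j^* eps. *)
  have epsI : injective (fmap j' (eps Q)).
    have [h hK hK'] := etaB (j' Q).
    move=> u v; rewrite -[u]hK' -[v]hK' [LHS](adj_triangleR adj) [RHS](adj_triangleR adj).
    by move=> ->.
  apply: epsI; rewrite [RHS](adj_triangleR adj).
  rewrite -[LHS]/((fmap j' (eps Q) \o fmap j' s) x).
  rewrite -(@fmap_compE _ _ j' _ _ _ (eps Q) s idfun) ?fmap_id// => z.
  by rewrite -[LHS]sE /= (@fmap_idE _ _ j_s).
move=> M M'' g f gS.
have [h hE] := projQ _ _ _ (fmap j_s f \o s : {linear _ -> _}) (jsS _ _ g gS).
have [etaM' [etaMK etaMK']] := linear_inverse (etaB M).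
have [etaM'' etaM''K _] := etaB M''.
exists (etaM' \o fmap j' h : {linear _ -> _}) => x; apply: (can_inj etaM''K) => /=.
rewrite -[LHS]/((eta M'' \o g) _) (adj_unit_nat adj g) /=.
rewrite [adj_unit _ _ _]etaMK'.
rewrite -[LHS]/((fmap j' (fmap j_s g) \o fmap j' h) x).
rewrite -(@fmap_compE _ _ j' _ _ _ _ _ (fmap j_s g \o h)) //.
rewrite (@fmap_compE _ _ j' _ _ _ (fmap j_s f) s) //= jsE.
exact/esym/(adj_unit_nat adj f).
Qed.

(** The image J of the unit is a submodule of i_* i^* Q, so it is killed by j^*
    and comes from A. The universal property of the unit then factors the unit
    of Q through J in such a way that the inclusion of J has a section. *)
Lemma i_up_unit_surj (Q : rmodType B) : surj (adj_unit (adj_i_up_low r) Q).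
Proof.
pose adj := adj_i_up_low r.
have [J [q [k [qS kI kq]]]] := image_factorization (adj_unit adj Q).
have J0 : fkernel j' J.
  apply: (fkernel_sub kI) => x.
  have /im_i_low_ker_j_up : fimage i_ (@all_rmod A) (i_ (i' Q)).
    by exists (i' Q) => //; exists idfun; exists id.
  exact.
have /im_i_low_ker_j_up[Z _ [u /linear_inverse[u' [uK u'K]]]] := J0.
pose g := untransp adj (u' \o q : {linear Q -> i_ Z}).
have [inv _ invK] := i_low_ff r Z (i' Q).
pose t := inv (k \o u : {linear _ -> _}); have tE : fmap i_ t = k \o u by apply: invK.
have tg : (t \o g : {linear _ -> _}) = idfun.
  apply: linear_ext => x; rewrite -[LHS](transpK adj) -[RHS](transpK adj).
  congr (untransp adj _ _); apply: linear_ext => y.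
  rewrite /= (@fmap_compE _ _ i_ _ _ _ t g) //= fmap_id tE /=.
  rewrite [fmap i_ g _](untranspK adj) /= u'K.
  exact: kq.
move=> y; have [x xE] := qS (u (fmap i_ g y)); exists x; rewrite -kq /= xE.
rewrite -[LHS]/((k \o u : {linear _ -> _}) _) -tE.
rewrite -[LHS]/((fmap i_ t \o fmap i_ g) y).
by rewrite -(@fmap_compE _ _ i_ _ _ _ t g idfun) ?fmap_id// => z; rewrite -tg.
Qed.

(** For k : K -> i^* Q that becomes surjective onto Z, the pullback L of i_* k
    along the unit Q -> i_* i^* Q maps onto i_* Z, so L = Q as the kernel of p
    is superfluous. Hence i_* k is surjective, and so is k = i^* i_* k. *)
Lemma right_perfect_of_i_low : right_perfect B -> right_perfect A.
Proof.
pose adj := adj_i_up_low r.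
have iS := left_adjoint_surj (adj_i_low_shriek r) (@i_low_additive _ _ _ r)
  (@i_shriek_additive _ _ _ r).
have i'S := left_adjoint_surj adj (@i_up_additive _ _ _ r) (@i_low_additive _ _ _ r).
have epsB Z : bijective (adj_counit adj Z) by apply: counit_bijective (i_low_ff r).
move=> perf Z; have [Q [p [projQ pS psup]]] := perf (i_ Z).
have p'S : surj (untransp adj p).
  move=> z; have [e' _ e'K] := epsB Z.
  by have [x xE] := i'S _ _ p pS (e' z); exists x; rewrite /= xE e'K.
exists (i' Q), (untransp adj p); split=> //.
  move=> M N g f gS; have [h hE] := projQ _ _ _ (transp adj f) (iS _ _ g gS).
  exists (untransp adj h) => x; rewrite -untransp_comp -[RHS](transpK adj).
  by congr (untransp adj _ _); apply: linear_ext.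
apply/superfluous_kerP => // K k kS.
have [||L [l [_ lE]]] := @submodule_exists _ Q
    (fun q => exists y, fmap i_ k y = adj_unit adj Q q).
- by exists 0; rewrite !linear0.
- by move=> a x y [x' xE] [y' yE]; exists (a *: x' + y'); rewrite !linearP xE yE.
have lS : surj l.
  apply: ((superfluous_kerP pS).1 psup) => z.
  have [y <-] := iS _ _ _ kS z.
  have [q qE] := i_up_unit_surj (fmap i_ k y).
  have /lE[x xq] : exists y, fmap i_ k y = adj_unit adj Q q by exists y.
  exists x; rewrite /= xq -(untranspK adj p) /= [adj_unit _ _ _]qE.
  by rewrite (@fmap_compE _ _ i_ _ _ _ (untransp adj p) k).
have ikS : surj (fmap i_ k).
  move=> y; have [q <-] := i_up_unit_surj y; have [x <-] := lS q.
  by apply/lE; exists x.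
move=> y; have [e' _ e'K] := epsB (i' Q).
have [x xE] := i'S _ _ _ ikS (e' y); exists (adj_counit adj K x).
by rewrite -[LHS]/((k \o _) x) (adj_counit_nat adj k) /= xE e'K.
Qed.

End Recollement.

(** * Cotorsion dimensions in a recollement *)

Lemma cotdim_class_eq (A : pzRingType) (X : rmod_class A) n :
  cotdim_class X = Some n -> forall M, X M -> injdim_le (@flat A) n M.
Proof. by move=> e; apply/cotdim_class_le; rewrite e /=. Qed.

Lemma fimage_self (A B : pzRingType) (F : rmod_functor A B) (X : rmod_class A) M :
  X M -> fimage F X (F M).
Proof. by move=> XM; exists M => //; exists idfun; exists id. Qed.

Lemma enat_leP (x y : enat) :
  (forall n, y = Some n -> (x <= Some n)%enat) -> (x <= y)%enat.
Proof. by case: y => [n|_]; [apply | case: x]. Qed.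

Theorem corollary3p7 (A B C : pzRingType) (r : recollement A B C) :
  let X' := @flat A in
  let X := @flat B in
  let X'' := @flat C in
  [/\ (cotdim_class (@all_rmod B) <=
        cotdim_class (@all_rmod A) + cotdim_class (@all_rmod C)
        + enat_max (cotdim_class (fimage (i_low r) (Ext_perp X')))
                   (cotdim_class (fimage (j_low r) (Ext_perp X'')))
        + Some 1)%enat,
      (cotdim_class (@all_rmod C) <=
        cotdim_class (@all_rmod B)
        + cotdim_class (fimage (j_up r) (Ext_perp X)))%enat,
      subclass (fimage (j_up r) (Ext_perp X)) (Ext_perp X'') ->
        (cotdim_class (@all_rmod C) <= cotdim_class (@all_rmod B))%enat
        /\ (right_perfect B -> right_perfect C) &
      exact_functor (i_shriek r) ->
      subclass (fimage (i_shriek r) (Ext_perp X)) (Ext_perp X') ->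
        (cotdim_class (@all_rmod A) <= cotdim_class (@all_rmod B))%enat
        /\ (right_perfect B -> right_perfect A)].
Proof.
move=> X' X X''; split.
- apply: enat_leP => n; case eA: (cotdim_class _) => [a|//].
  case eC: (cotdim_class _) => [c|//]; case ei: (cotdim_class _) => [mi|//].
  case ej: (cotdim_class _) => [mj|//] [<-].
  apply/cotdim_class_le => M _; apply: injdim_le_recollement.
  + by move=> Z; apply: (cotdim_class_eq eA).
  + by move=> Z; apply: (cotdim_class_eq eC).
  + move=> Y /(fimage_self (i_low r))/(cotdim_class_eq ei).
    exact/injdim_le_mono/leq_maxl.
  + move=> Y /(fimage_self (j_low r))/(cotdim_class_eq ej).
    exact/injdim_le_mono/leq_maxr.
- apply: enat_leP => n; case eB: (cotdim_class _) => [b|//].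
  case ej: (cotdim_class _) => [m|//] [<-].
  apply/cotdim_class_le => N _; apply: (injdim_le_iso (j_up_low_iso r N)).
  apply: (injdim_le_functor (j_up_exact r)); last exact: (cotdim_class_eq eB).
  by move=> Y /(fimage_self (j_up r))/(cotdim_class_eq ej).
- move=> hj; split; last exact: (right_perfect_of_j_shriek r).
  apply: enat_leP => b eB; apply/cotdim_class_le => N _.
  apply: (injdim_le_iso (j_up_low_iso r N)); rewrite -[b]addn0.
  apply: (injdim_le_functor (j_up_exact r)); last exact: (cotdim_class_eq eB).
  by move=> Y /(fimage_self (j_up r))/hj.
- move=> iex hi; split; last exact: (right_perfect_of_i_low r).
  apply: enat_leP => b eB; apply/cotdim_class_le => N _.
  apply: (injdim_le_iso (i_shriek_low_iso r N)); rewrite -[b]addn0.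
  apply: (injdim_le_functor iex); last exact: (cotdim_class_eq eB).
  by move=> Y /(fimage_self (i_shriek r))/hi.
Qed.
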